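(* Let $n$ be a positive integer and assume that there exists an Hadamard matrix of order $n$. Let $G$ be a finite abelian group, written additively, and $N$ a subgroup of $G$ with $|G|=\frac{n(n-1)}{2}$ and $|N|=\frac n2$. Let $\mathcal F=\{D_1,D_2\}$ be a $$\Bigl(G,\,N,\,\tfrac{n(n-2)}{4},\,\tfrac{n(n-4)}{4},\,\tfrac{n(n-3)}{4}\Bigr)\text{-DDF}.$$ Assume further that $\mathcal F$ satisfies the following conditions: (i) if $a\in D_1$, then $-a\in D_1$; (ii) for each $i=1,2$, $|D_i\cap N|=0$ and $|D_i\cap (N+j)|=n/4$ for every $j\in G\setminus N$. Then there exists a symmetric Hadamard matrix of order $n^2$.
   Context: An $m\times m$ matrix $M$ with entries in $\{1,-1\}$ is an Hadamard matrix of order $m$ if $MM^{T}=mI_m$; it is symmetric if $M=M^T$. For a finite abelian group $G$ (additive), a subgroup $N$, and an indexed family $\mathcal F=\{D_i\mid 1\le i\le b\}$ of subsets (''blocks'') of $G$, put $\theta_{\mathcal F}(d)=\sum_{i=1}^b|\{(x,y)\mid x,y\in D_i,\ x\neq y,\ x-y=d\}|$ for $d\in G$. $\mathcal F$ is a $(G,N,k,\lambda,\mu)$ divisible difference family ($(G,N,k,\lambda,\mu)$-DDF) if $|D_i|=k$ for all $i$, $\theta_{\mathcal F}(d)=\lambda$ for all $d\in N\setminus\{0\}$, and $\theta_{\mathcal F}(d)=\mu$ for all $d\in G\setminus N$. *)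

(* Defs.v *)
From mathcomp Require Import all_boot all_order all_algebra.
Set Implicit Arguments.
Unset Strict Implicit.
Unset Printing Implicit Defensive.
Import GRing.Theory.
Local Open Scope ring_scope.

Definition is_hadamard (m : nat) (M : 'M[int]_m) : Prop :=
  (forall i j, M i j = 1 \/ M i j = -1) /\ M *m M^T = (m%:R)%:M.

Definition is_symmetric_hadamard (m : nat) (M : 'M[int]_m) : Prop :=
  is_hadamard M /\ M = M^T.

Definition theta (G : finZmodType) (b : nat) (D : 'I_b -> {set G}) (d : G) : nat :=
  (\sum_(i < b) #|[set p : G * G |
     [&& p.1 \in D i, p.2 \in D i, p.1 != p.2 & p.1 - p.2 == d]%R]|)%N.

Definition coset_add (G : finZmodType) (N : {set G}) (j : G) : {set G} :=
  [set x + j | x in N].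

(* The parameters are rational so that expressions such as n(n-3)/4 are meant
   literally: no truncated subtraction or division, and the equations below
   force integrality whenever they are not vacuous. *)
Definition is_DDF (G : finZmodType) (N : {set G}) (k lambda mu : rat)
    (b : nat) (D : 'I_b -> {set G}) : Prop :=
  [/\ forall i, #|D i|%:R = k,
      forall d, d \in N -> d != 0 -> (theta D d)%:R = lambda
    & forall d, d \notin N -> (theta D d)%:R = mu].

(* Main.v *)
Require Import Defs.
From mathcomp Require Import all_boot all_order all_algebra.
From mathcomp Require Import ring.
Set Implicit Arguments.
Unset Strict Implicit.
Unset Printing Implicit Defensive.
Import GRing.Theory.
Local Open Scope ring_scope.

(** Write m = n/2 = |N|, let a and b be the sign functions of D_1 and D_2 (value
    -1 on the block, 1 off it), and let A = (a(x - y)), B = (b(x - y)) and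
    P = (1 if x - y is in N, else 0) be the matrices indexed by G that they
    develop.  All three commute because G is abelian, and A is symmetric by
    condition (i).

    The difference family parameters say exactly that
      A A^T + B B^T = n^2 I - n P,
    and condition (ii) that A P = B P = m P: the sum of a over a coset of N is m
    on N itself, where a = 1, and 0 on every other coset.

    A matrix of order |G| + |G| built from A and B falls short of n^2 by n
    rows and columns.  The Hadamard matrix H of order n supplies them.
    Label the n - 1 cosets of N by the columns of H other than a distinguished
    column h, and let Y be the n by |G| matrix whose column x is
    the column of H labelling the coset of x.  Then
      Y^T Y = n P,   Y P = m Y,   Y Y^T = m (n I - h h^T),   h^T Y = 0,
    and condition (ii) gives Y A = Y B = m Y (lemma [balanced_conv]).  The
    required matrix is
        [ h h^T     Y       -Y     ]
        [  Y^T      A        B     ]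
        [ -Y^T     B^T    2P - A   ].
    The corner is 2P - A rather than -A because A carries the all-one block on N:
    with A_0 = A - P and B_0 = B - P, which P annihilates, the lower right part
    is [A_0, B_0; B_0^T, -A_0] plus [P, P; P, P].  The first summand squares to
    the block diagonal matrix with blocks n^2 I - 2n P, the second to n P in all
    four blocks, and their products with each other vanish.  The rows Y, -Y
    contribute n P on the diagonal blocks and -n P off them, which restores
    n^2 I.  These relations are checked in
    [bordered_gram]; [sgn_corr] with [theta_sum], and [sgn_balanced],
    translate the hypotheses on D_1 and D_2 into statements about a and b. *)

(** * Hadamard matrices *)

(** Lets the rows be indexed by the disjoint union of the index sets of the
    blocks, so that no block matrix ever has to be cast to size n^2. *)
Lemma hadamard_of_array (T : finType) (m : nat) (f : T -> T -> int) :
  #|T| = m ->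
  (forall s t, f s t = 1 \/ f s t = -1) ->
  (forall s t, f s t = f t s) ->
  (forall s t, \sum_u f s u * f t u = m%:R * (s == t)%:R) ->
  exists S : 'M[int]_m, is_symmetric_hadamard S.
Proof.
move=> <- f_pm f_sym f_gram.
exists (\matrix_(i, j) f (enum_val i) (enum_val j)); split; last first.
  by apply/matrixP => i j; rewrite !mxE f_sym.
split=> [i j|]; first by rewrite mxE.
apply/matrixP => i j; rewrite !mxE.
transitivity (\sum_u f (enum_val i) u * f (enum_val j) u).
  rewrite [RHS](reindex (fun k : 'I_#|T| => enum_val k)); last first.
    exact/onW_bij/enum_val_bij.
  by apply: eq_bigr => k _; rewrite !mxE.
by rewrite f_gram (inj_eq enum_val_inj) mulr_natr.
Qed.

Lemma hadamard_row_dot (n : nat) (H : 'M[int]_n) : is_hadamard H ->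
  forall i j, \sum_k H i k * H j k = n%:R * (i == j)%:R.
Proof.
move=> [_ /matrixP HHt] i j; move: (HHt i j); rewrite !mxE mulr_natr => <-.
by apply: eq_bigr => k _; rewrite mxE.
Qed.

(** Over a field, a right inverse of a square matrix is a left inverse; so the
    columns are orthogonal once the rows are.  The field is the rationals. *)
Lemma hadamard_col_dot (n : nat) (H : 'M[int]_n) : (0 < n)%N ->
  is_hadamard H -> forall k l, \sum_i H i k * H i l = n%:R * (k == l)%:R.
Proof.
move=> n_gt0 [_ HHt] k l.
pose Q := map_mx (intr : int -> rat) H.
have nQ0 : n%:R != 0 :> rat by rewrite Num.Theory.pnatr_eq0 -lt0n.
have QQt : Q *m (n%:R^-1 *: Q^T) = 1%:M.
  rewrite -scalemxAr map_trmx -map_mxM HHt map_scalar_mx /=.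
  by rewrite rmorph_nat -scalemx1 scalerA mulVf // scale1r.
have /matrixP/(_ l k) := mulmx1C QQt; rewrite !mxE => Qkl.
apply: (@intr_inj rat).
rewrite rmorph_sum rmorphM /= !rmorph_nat eq_sym -Qkl mulr_sumr.
apply: eq_bigr => i _; rewrite !mxE rmorphM /= mulrA mulrA divff // mul1r mulrC.
by [].
Qed.

(** * Cosets of a subgroup and functions balanced on them *)

Section Cosets.

Variables (G : finZmodType) (N : {set G}).
Hypothesis subgroupN : zmod_closed N.

Lemma mem_subgroupB x y : x \in N -> y \in N -> x - y \in N.
Proof. by case: subgroupN => _; apply. Qed.

Lemma mem_subgroup0 : 0 \in N.
Proof. by case: subgroupN. Qed.

Lemma mem_subgroupN x : (- x \in N) = (x \in N).
Proof.
have NN y : y \in N -> - y \in N.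
  by move=> yN; rewrite -[- y]add0r mem_subgroupB ?mem_subgroup0.
by apply/idP/idP => [/NN|/NN //]; rewrite opprK.
Qed.

Lemma mem_subgroupDl x y : x \in N -> (x + y \in N) = (y \in N).
Proof.
move=> xN; apply/idP/idP => yN.
  by rewrite -(addKr x y) addrC mem_subgroupB.
by rewrite -[x]opprK addrC mem_subgroupB // mem_subgroupN.
Qed.

Lemma mem_coset_add x j : (x \in coset_add N j) = (x - j \in N).
Proof.
apply/imsetP/idP => [[y yN ->]|xjN]; first by rewrite addrK.
by exists (x - j) => //; rewrite subrK.
Qed.

Lemma eq_coset_add x y : (coset_add N x == coset_add N y) = (x - y \in N).
Proof.
apply/eqP/idP => [eq_xy|xyN].
  by rewrite -mem_coset_add -eq_xy mem_coset_add subrr mem_subgroup0.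
apply/setP => z; rewrite !mem_coset_add.
by rewrite -(mem_subgroupDl (z - x) xyN) addrC addrA subrK.
Qed.

Lemma card_coset y : #|[pred x | x - y \in N]| = #|N|.
Proof.
rewrite -(card_imset _ (addIr y)); apply: eq_card => x.
by rewrite inE -mem_coset_add.
Qed.

Lemma card_cosets : (#|[set coset_add N x | x : G]| * #|N| = #|G|)%N.
Proof.
rewrite -[RHS]sum1_card.
rewrite (partition_big (coset_add N) [in [set coset_add N x | x : G]]) /=.
  rewrite -sum_nat_const; apply: eq_bigr => _ /imsetP[y _ ->].
  rewrite -(card_coset y) -[LHS]sum1_card.
  by apply: eq_bigl => x; rewrite inE -eq_coset_add.
by move=> x _; apply: imset_f.
Qed.

(** There are as many cosets as elements of I other than o, so the cosets can be
    matched with these elements by their rank in the two enumerations. *)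
Lemma exists_coset_labels (I : finType) (o : I) :
  (#|G| = #|N| * #|I|.-1)%N ->
  exists2 c : G -> I, forall x, c x != o &
    forall x y, (c x == c y) = (x - y \in N).
Proof.
move=> cardG; set P := [set coset_add N x | x : G].
have N_gt0 : (0 < #|N|)%N by apply/card_gt0P; exists 0; apply: mem_subgroup0.
have cardP : #|P| = #|[set~ o]|.
  apply/eqP; rewrite cardsC1 -(eqn_pmul2r N_gt0) card_cosets cardG mulnC.
  by [].
pose c x := nth o (enum [set~ o]) (index (coset_add N x) (enum P)).
have lt_c x : (index (coset_add N x) (enum P) < size (enum [set~ o]))%N.
  by rewrite -cardE -cardP cardE index_mem mem_enum imset_f.
exists c => [x|x y]; first by have := mem_nth o (lt_c x); rewrite mem_enum !inE.
rewrite /c nth_uniq ?enum_uniq ?lt_c // -eq_coset_add.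
apply/eqP/eqP => [eq_xy|-> //].
by apply: (index_inj set0 _ _ eq_xy); rewrite mem_enum imset_f.
Qed.

(** Every fibre of c is empty or a coset, so has at most |N| elements; the fibres
    over the |I| - 1 labels other than o have total size |N| (|I| - 1), hence
    each has exactly |N| elements: every label occurs. *)
Lemma sum_coset_labels (I : finType) (o : I) (c : G -> I) (F : I -> int) :
  (#|G| = #|N| * #|I|.-1)%N ->
  (forall x, c x != o) ->
  (forall x y, (c x == c y) = (x - y \in N)) ->
  \sum_x F (c x) = #|N|%:R * \sum_(k | k != o) F k.
Proof.
move=> cardG c_o c_eq.
have fibre k : (#|[pred x | c x == k]| <= #|N|
    ?= iff (#|[pred x | c x == k]| == #|N|))%N.
  split=> //; case: (pickP [pred x | c x == k]) => [y /= /eqP <-|/eq_card ->].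
    by rewrite -(card_coset y); apply/eq_leq/eq_card => x; rewrite !inE c_eq.
  by rewrite card0.
have [_] := leqif_sum (fun k (_ : k != o) => fibre k).
rewrite sum_nat_const cardC1 mulnC -cardG.
have -> : (\sum_(k | k != o) #|[pred x | c x == k]| = #|G|)%N.
  rewrite -sum1_card (partition_big c (fun k => k != o)) //=.
  by apply: eq_bigr => k _; rewrite sum1_card.
rewrite eqxx => /esym/forall_inP full.
rewrite (partition_big c (fun k => k != o)) //= mulr_sumr.
apply: eq_bigr => k /full/eqP <-.
rewrite (eq_bigr (fun=> F k)); last by move=> x /eqP ->.
by rewrite sumr_const mulr_natl.
Qed.

Definition ind (x : G) : int := (x \in N)%:R.

Lemma indN x : ind (- x) = ind x.
Proof. by rewrite /ind mem_subgroupN. Qed.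

Lemma sum_ind x : \sum_z ind (x - z) = #|N|%:R.
Proof.
rewrite -(card_coset x) -sum1_card natr_sum [RHS]big_mkcond /=.
by apply: eq_bigr => z _; rewrite inE -indN opprB /ind; case: ifP.
Qed.

(** P f = |N| P as G-developed matrices: f sums to |N| over N and to 0 over each
    other coset. *)
Definition coset_balanced (f : G -> int) :=
  forall x, \sum_z ind (x - z) * f z = #|N|%:R * ind x.

Lemma mulind_periodic (g : G -> int) :
  (forall x y, x - y \in N -> g x = g y) ->
  forall x y, ind (x - y) * g y = ind (x - y) * g x.
Proof.
move=> g_per x y; rewrite /ind.
by case: (boolP (x - y \in N)) => [/g_per ->|_] //; rewrite !mul0r.
Qed.

Lemma ind_balanced : coset_balanced ind.
Proof.
move=> x; have ind_per y z : y - z \in N -> ind y = ind z.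
  by move=> yzN; rewrite /ind -{1}(subrK z y) (mem_subgroupDl _ yzN).
under eq_bigr => z _ do rewrite (mulind_periodic ind_per x z).
by rewrite -mulr_suml sum_ind.
Qed.

Lemma balanced_rev f : coset_balanced f -> coset_balanced (fun z => f (- z)).
Proof.
move=> bal_f x; rewrite (reindex_inj oppr_inj) /= -[in RHS]indN -bal_f.
by apply: eq_bigr => z _; rewrite -[in RHS]indN opprB !opprK addrC.
Qed.

(** A function g constant on cosets is its own average, |N| g = P g; so
    |N| (f g) = f P g = |N| P g = |N|^2 g, and |N| cancels. *)
Lemma balanced_conv f g : coset_balanced f ->
  (forall x y, x - y \in N -> g x = g y) ->
  forall y, \sum_z g z * f (y - z) = #|N|%:R * g y.
Proof.
move=> bal_f g_per y.
have N0 : #|N|%:R != 0 :> int.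
  rewrite Num.Theory.pnatr_eq0 -lt0n; apply/card_gt0P; exists 0.
  exact: mem_subgroup0.
have avg x : \sum_w ind (x - w) * g w = #|N|%:R * g x.
  under eq_bigr => w _ do rewrite (mulind_periodic g_per x w).
  by rewrite -mulr_suml sum_ind.
apply: (mulfI N0); rewrite mulr_sumr.
transitivity (\sum_z \sum_w g w * (ind (z - w) * f (y - z))).
  apply: eq_bigr => z _; rewrite mulrA -avg mulr_suml.
  by apply: eq_bigr => w _; ring.
rewrite exchange_big /= -avg mulr_sumr; apply: eq_bigr => w _.
rewrite -mulr_sumr (reindex_inj (inj_comp (addrI y) oppr_inj)) /=.
transitivity (g w * (#|N|%:R * ind (y - w))); last by ring.
congr (_ * _); rewrite -bal_f; apply: eq_bigr => z _.
by rewrite subKr addrAC.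
Qed.

End Cosets.

(** * The bordered array *)

Section Bordered.

Variables (G : finZmodType) (N : {set G}) (n : nat) (H : 'M[int]_n).
Variables (o : 'I_n) (c : G -> 'I_n) (a b : G -> int).
Hypothesis subgroupN : zmod_closed N.
Hypothesis hadamardH : is_hadamard H.
Hypothesis cardN : (2 * #|N| = n)%N.
Hypothesis cardG : (#|G| = #|N| * n.-1)%N.
Hypothesis c_o : forall x, c x != o.
Hypothesis c_eq : forall x y, (c x == c y) = (x - y \in N).
Hypothesis a_pm : forall x, a x = 1 \/ a x = -1.
Hypothesis b_pm : forall x, b x = 1 \/ b x = -1.
Hypothesis aN : forall x, a (- x) = a x.
Hypothesis a_in : forall x, x \in N -> a x = 1.
Hypothesis bal_a : coset_balanced N a.
Hypothesis bal_b : coset_balanced N b.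
Hypothesis corr : forall d,
  \sum_z a z * a (d + z) + \sum_z b z * b (d + z) =
    n%:R ^+ 2 * (d == 0)%:R - n%:R * ind N d.

Local Notation p := (ind N).

(** The block matrix [h h^T, Y, -Y; Y^T, A, B; -Y^T, B^T, 2P - A]. *)
Definition bordered (s t : 'I_n + (G + G)) : int :=
  match s, t with
  | inl i, inl j => H i o * H j o
  | inl i, inr (inl x) | inr (inl x), inl i => H i (c x)
  | inl i, inr (inr x) | inr (inr x), inl i => - H i (c x)
  | inr (inl x), inr (inl y) => a (x - y)
  | inr (inl x), inr (inr y) => b (x - y)
  | inr (inr x), inr (inl y) => b (y - x)
  | inr (inr x), inr (inr y) => 2 * p (x - y) - a (x - y)
  end.

(** The corner 2P - A has entries 2 - 1 = 1 on N, where a = 1, and -a off N. *)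
Lemma bordered_pm s t : bordered s t = 1 \/ bordered s t = -1.
Proof.
have H_pm := hadamardH.1.
have pmN z : z = 1 \/ z = -1 -> - z = 1 \/ - z = -1 :> int.
  by case=> ->; [right|left; rewrite opprK].
case: s t => [i|[x|x]] [j|[y|y]] //=; try exact: pmN.
  by case: (H_pm i o) => ->; rewrite ?mul1r ?mulN1r //; apply: pmN.
rewrite /ind; case: (boolP (x - y \in N)) => [/a_in ->|_]; first by left.
by rewrite mulr0 sub0r; apply: pmN.
Qed.

Lemma bordered_sym s t : bordered s t = bordered t s.
Proof.
case: s t => [i|[x|x]] [j|[y|y]] //=.
- by rewrite mulrC.
- by rewrite -aN opprB.
by rewrite -(indN subgroupN) -aN opprB.
Qed.

Lemma card_bordered : #|{: 'I_n + (G + G)}| = (n ^ 2)%N.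
Proof.
rewrite !card_sum card_ord addnn -mul2n cardG mulnA cardN -mulnS.
by rewrite prednK ?mulnn //; apply: leq_ltn_trans (ltn_ord o).
Qed.

Lemma sum_bordered (F : 'I_n + (G + G) -> int) :
  \sum_u F u =
    \sum_k F (inl k) + (\sum_x F (inr (inl x)) + \sum_x F (inr (inr x))).
Proof. by rewrite !big_sumType. Qed.

Lemma sumB_sub (F : G -> G -> int) x y :
  \sum_z F (x - z) (y - z) = \sum_z F z (y - x + z).
Proof.
rewrite (reindex_inj (inj_comp (addrI x) oppr_inj)) /=.
by apply: eq_bigr => z _; rewrite opprB addrC subrK addrA addrAC.
Qed.

Lemma sum_sub (F : G -> G -> int) x y :
  \sum_z F (z - x) (z - y) = \sum_z F z (x - y + z).
Proof.
rewrite (reindex_inj (addIr x)) /=.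
by apply: eq_bigr => z _; rewrite addrK -addrA addrC.
Qed.

Let n0 : (0 < n)%N. Proof. exact: leq_ltn_trans (ltn_ord o). Qed.
Let nE : n%:R = 2 * #|N|%:R :> int.
Proof. by rewrite -cardN natrM. Qed.

Lemma H_periodic i x y : x - y \in N -> H i (c x) = H i (c y).
Proof. by rewrite -c_eq => /eqP ->. Qed.

(** Only the relations between A, B, P, Y and h enter: h is orthogonal to the
    other columns ([row0]), Y^T Y = n P ([col0]), Y Y^T = m (n I - h h^T) ([YY]),
    Y f = m Y and P f = m P for balanced f ([convY], [convp]), and the correlation
    identity.  As the Gram matrix is symmetric, six blocks suffice. *)
Lemma bordered_gram s t :
  \sum_u bordered s u * bordered t u = (n ^ 2)%:R * (s == t)%:R.
Proof.
have comm s' t' : \sum_u bordered s' u * bordered t' u =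
    \sum_u bordered t' u * bordered s' u.
  by apply: eq_bigr => u _; rewrite mulrC.
have rowdot := hadamard_row_dot hadamardH.
have coldot := hadamard_col_dot n0 hadamardH.
have bal_b' := balanced_rev subgroupN bal_b.
have convY f i y : coset_balanced N f ->
    \sum_z H i (c z) * f (y - z) = #|N|%:R * H i (c y).
  by move=> bal_f; apply: balanced_conv (@H_periodic i) y.
have convp f x y : coset_balanced N f ->
    \sum_z p (x - z) * f (y - z) = #|N|%:R * p (x - y).
  move=> bal_f.
  rewrite (balanced_conv (g := fun z => p (x - z)) subgroupN bal_f) //.
  move=> u v uv; rewrite /ind -(mem_subgroupDl subgroupN (x - u) uv).
  by rewrite addrC addrA subrK.
have col0 x y : \sum_k H k (c x) * H k (c y) = n%:R * p (x - y).
  by rewrite coldot c_eq.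
have row0 i y : \sum_k H i o * H k o * H k (c y) = 0.
  under eq_bigr => k _ do rewrite -mulrA.
  by rewrite -mulr_sumr coldot eq_sym (negbTE (c_o y)) !mulr0.
have ip i x : \sum_z H i (c z) * p (x - z) = #|N|%:R * H i (c x).
  by apply: convY; apply: ind_balanced.
have YY i j : \sum_x H i (c x) * H j (c x) =
    #|N|%:R * (n%:R * (i == j)%:R - H i o * H j o).
  rewrite (@sum_coset_labels _ N _ o c (fun k => H i k * H j k)) ?card_ord //.
  by congr (_ * _); rewrite -rowdot [in RHS](bigD1 o) //= [RHS]addrC addKr.
have XX i j : \sum_k H i o * H k o * (H j o * H k o) = n%:R * (H i o * H j o).
  under eq_bigr => k _ do rewrite mulrACA.
  by rewrite -mulr_sumr coldot eqxx mulr1 mulrC.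
have g11 i j : \sum_u bordered (inl i) u * bordered (inl j) u =
    (n ^ 2)%:R * (i == j)%:R.
  rewrite sum_bordered /= XX.
  under [X in _ + (_ + X)]eq_bigr => x _ do rewrite mulrNN.
  by rewrite !YY natrX nE; ring.
have g12 i y : \sum_u bordered (inl i) u * bordered (inr (inl y)) u = 0.
  rewrite sum_bordered /= row0 add0r.
  under [X in _ + X]eq_bigr => x _ do rewrite mulNr.
  by rewrite sumrN !convY // subrr.
have g13 i y : \sum_u bordered (inl i) u * bordered (inr (inr y)) u = 0.
  rewrite sum_bordered /=.
  under eq_bigr => k _ do rewrite mulrN.
  rewrite sumrN row0 oppr0 add0r.
  have -> : \sum_z H i (c z) * b (z - y) = #|N|%:R * H i (c y).
    by rewrite -(convY _ _ _ bal_b'); apply: eq_bigr => z _; rewrite opprB.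
  have -> : \sum_z - H i (c z) * (2 * p (y - z) - a (y - z)) =
      \sum_z H i (c z) * a (y - z) - 2 * \sum_z H i (c z) * p (y - z).
    by rewrite mulr_sumr -sumrB; apply: eq_bigr => z _; ring.
  by rewrite convY // ip; ring.
have g22 x y : \sum_u bordered (inr (inl x)) u * bordered (inr (inl y)) u =
    (n ^ 2)%:R * (x == y)%:R.
  rewrite sum_bordered /= col0 (sumB_sub (fun u v => a u * a v)).
  rewrite (sumB_sub (fun u v => b u * b v)) corr -(indN subgroupN) opprB.
  by rewrite subr_eq0 [y == x]eq_sym natrX; ring.
have g23 x y : \sum_u bordered (inr (inl x)) u * bordered (inr (inr y)) u = 0.
  rewrite sum_bordered /=.
  under eq_bigr => k _ do rewrite mulrN.
  rewrite sumrN col0.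
  (* The substitution z -> x + y - z and the symmetry of a: A B = B A. *)
  have -> : \sum_z a (x - z) * b (z - y) = \sum_z a (y - z) * b (x - z).
    rewrite (reindex_inj (inj_comp (addrI (x + y)) oppr_inj)) /=.
    apply: eq_bigr => z _; rewrite -[in LHS]aN; congr (a _ * b _).
      by rewrite opprB addrAC [x + y]addrC addrK.
    by rewrite addrAC addrK.
  have -> : \sum_z b (x - z) * (2 * p (y - z) - a (y - z)) =
      2 * \sum_z p (y - z) * b (x - z) - \sum_z a (y - z) * b (x - z).
    by rewrite mulr_sumr -sumrB; apply: eq_bigr => z _; ring.
  by rewrite convp // nE -[p (y - x)](indN subgroupN) opprB; ring.
have g33 x y : \sum_u bordered (inr (inr x)) u * bordered (inr (inr y)) u =
    (n ^ 2)%:R * (x == y)%:R.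
  rewrite sum_bordered /=.
  under eq_bigr => k _ do rewrite mulrNN.
  rewrite col0 (sum_sub (fun u v => b u * b v)).
  have -> : \sum_z (2 * p (x - z) - a (x - z)) * (2 * p (y - z) - a (y - z)) =
      4 * (\sum_z p (x - z) * p (y - z)) - 2 * (\sum_z p (x - z) * a (y - z))
      - 2 * (\sum_z p (y - z) * a (x - z)) + \sum_z a (y - z) * a (x - z).
    rewrite !mulr_sumr -!sumrB -big_split /=.
    by apply: eq_bigr => z _; ring.
  rewrite (sumB_sub (fun u v => a u * a v)) !convp //; last exact: ind_balanced.
  rewrite -[p (y - x)](indN subgroupN) opprB natrX.
  have := corr (x - y); rewrite subr_eq0 => /(canRL (addrK _)) ->.
  by rewrite nE; ring.
case: s t => [i|[x|x]] [j|[y|y]].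
- exact: g11.
- by rewrite g12 mulr0.
- by rewrite g13 mulr0.
- by rewrite comm g12 mulr0.
- exact: g22.
- by rewrite g23 mulr0.
- by rewrite comm g13 mulr0.
- by rewrite comm g23 mulr0.
exact: g33.
Qed.

End Bordered.

(** * Sign functions of the blocks *)

Section SignFunction.

Variables (G : finZmodType) (N : {set G}).
Hypothesis subgroupN : zmod_closed N.

Definition sgn (A : {set G}) (x : G) : int := 1 - 2 * (x \in A)%:R.

Lemma sgn_pm A x : sgn A x = 1 \/ sgn A x = -1.
Proof. by rewrite /sgn; case: (x \in A); [right|left]. Qed.

Lemma sum_mem (A : {pred G}) : \sum_z (z \in A)%:R = #|A|%:R :> int.
Proof.
rewrite -sum1_card natr_sum [RHS]big_mkcond.
by apply: eq_bigr => z _; case: ifP.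
Qed.

(** Expand (1 - 2u)(1 - 2v) for u, v the indicators of A and of A - d; both have
    sum |A|. *)
Lemma sgn_corr A d : \sum_z sgn A z * sgn A (d + z) =
  #|G|%:R - 4 * #|A|%:R + 4 * #|[pred z | (z \in A) && (d + z \in A)]|%:R.
Proof.
have -> : #|G|%:R = \sum_(z : G) 1 :> int by rewrite sumr_const.
have shift : \sum_z (d + z \in A)%:R = #|A|%:R :> int.
  by rewrite -sum_mem [RHS](reindex_inj (addrI d)).
transitivity (\sum_(z : G) 1 - 2 * \sum_z (z \in A)%:R
    - 2 * \sum_z (d + z \in A)%:R
    + 4 * \sum_z (z \in [pred z | (z \in A) && (d + z \in A)])%:R : int).
  rewrite !mulr_sumr -!sumrB -big_split /=; apply: eq_bigr => z _.
  by rewrite inE -mulnb natrM /sgn; ring.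
by rewrite shift !sum_mem; ring.
Qed.

(** For d <> 0 the pairs in D_i with difference d are the (d + y, y), whose
    entries differ because d <> 0. *)
Lemma theta_sum (k : nat) (D : 'I_k -> {set G}) (d : G) : d != 0 ->
  theta D d = (\sum_(i < k) #|[pred z | (z \in D i) && (d + z \in D i)%R]|)%N.
Proof.
move=> d0; apply: eq_bigr => i _.
have inj_f : injective (fun z : G => (d + z, z)) by move=> u v [].
rewrite -(card_imset _ inj_f); apply: eq_card => [[x y]]; rewrite !inE /=.
apply/and4P/imsetP => [[xD yD xy /eqP <-]|[z]].
  by exists y; rewrite ?inE ?subrK ?yD.
rewrite inE => /andP[zD dzD] [-> ->]; split=> //; last by rewrite addrK.
by rewrite -subr_eq0 addrK.
Qed.

(** On a coset met by A in half of its points the signs cancel; N, which A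
    misses, contributes |N|. *)
Lemma sgn_balanced A : #|A :&: N| = 0%N ->
  (forall j, j \notin N -> (2 * #|A :&: coset_add N j| = #|N|)%N) ->
  coset_balanced N (sgn A).
Proof.
move=> AN ANj x.
have -> : \sum_z ind N (x - z) * sgn A z =
    #|N|%:R - 2 * #|A :&: coset_add N x|%:R.
  rewrite -(sum_ind subgroupN x) -sum_mem mulr_sumr -sumrB.
  apply: eq_bigr => z _; rewrite inE mem_coset_add -(indN subgroupN).
  by rewrite opprB -mulnb natrM /sgn /ind; ring.
rewrite /ind; case: (boolP (x \in N)) => [xN|/ANj <-]; last first.
  by rewrite natrM mulr0 subrr.
have -> : coset_add N x = N.
  apply/setP => z; rewrite mem_coset_add addrC.
  by rewrite mem_subgroupDl // mem_subgroupN.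
by rewrite AN mulr0 subr0 mulr1.
Qed.

End SignFunction.

Theorem theorem4p1 (n : nat) (n_gt0 : (0 < n)%N)
  (hadamard_n : exists H : 'M[int]_n, is_hadamard H)
  (G : finZmodType) (N : {set G}) (subgroupN : zmod_closed N)
  (cardG : #|G|%:R = n%:R * (n%:R - 1) / 2 :> rat)
  (cardN : #|N|%:R = n%:R / 2 :> rat)
  (D : 'I_2 -> {set G})
  (ddfD : is_DDF N (n%:R * (n%:R - 2) / 4) (n%:R * (n%:R - 4) / 4)
                   (n%:R * (n%:R - 3) / 4) D)
  (symD1 : forall a : G, a \in D ord0 -> - a \in D ord0)
  (meetN : forall i : 'I_2, #|D i :&: N| = 0%N)
  (meetNj : forall (i : 'I_2) (j : G), j \notin N ->
     #|D i :&: coset_add N j|%:R = n%:R / 4 :> rat) :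
  exists S : 'M[int]_(n ^ 2), is_symmetric_hadamard S.
Proof.
have [H hadH] := hadamard_n; have [cardD thetaN thetaNC] := ddfD.
have natE (x y : nat) : x%:R = y%:R :> rat -> x = y.
  by move/eqP; rewrite Num.Theory.eqr_nat => /eqP.
have intE (x y : int) : x%:~R = y%:~R :> rat -> x = y by move/intr_inj.
have nN : (2 * #|N| = n)%N by apply: natE; rewrite natrM cardN; field.
have GN : (#|G| = #|N| * n.-1)%N.
  by apply: natE; rewrite natrM cardG cardN -subn1 natrB //; field.
have DN i j : j \notin N -> (2 * #|D i :&: coset_add N j| = #|N|)%N.
  by move=> /(meetNj i) Dij; apply: natE; rewrite natrM Dij cardN; field.
have G2 : 2 * #|G|%:R = n%:R * (n%:R - 1) :> int.
  apply: intE; rewrite !(rmorphM, rmorphB, rmorph_nat, rmorph1) /= cardG.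
  by field.
have D4 i : 4 * #|D i|%:R = n%:R * (n%:R - 2) :> int.
  by apply: intE; rewrite !(rmorphM, rmorphB, rmorph_nat) /= cardD; field.
have balD i := sgn_balanced subgroupN (meetN i) (DN i).
(* Any column of H may serve as the distinguished column h. *)
pose o := Ordinal n_gt0.
have [|c c_o c_eq] := @exists_coset_labels _ _ subgroupN 'I_n o.
  by rewrite card_ord.
set D1 := D ord0 in symD1; set D2 := D (lift ord0 ord0).
have sgnN x : sgn D1 (- x) = sgn D1 x.
  congr (1 - 2 * (nat_of_bool _)%:R); apply/idP/idP => /symD1 //.
  by rewrite opprK.
have sgn1 x : x \in N -> sgn D1 x = 1.
  move=> xN; rewrite /sgn; case: (boolP (x \in D1)) => // xD.
  have /eqP := meetN ord0; rewrite cards_eq0 => /eqP/setP/(_ x).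
  by rewrite !inE xD xN.
have sgnK A x : sgn A x * sgn A x = 1 by case: (sgn_pm A x) => ->.
have corr d :
    \sum_z sgn D1 z * sgn D1 (d + z) + \sum_z sgn D2 z * sgn D2 (d + z) =
      n%:R ^+ 2 * (d == 0)%:R - n%:R * ind N d.
  (* theta omits the pairs x = y, so it carries no information at d = 0, where
     the correlation is a sum of 2 |G| squares of signs. *)
  have [->|d0] := eqVneq d 0.
    under eq_bigr => z _ do rewrite add0r sgnK.
    under [X in _ + X]eq_bigr => z _ do rewrite add0r sgnK.
    have -> : \sum_(z : G) 1 = #|G|%:R :> int by rewrite sumr_const.
    rewrite /ind (mem_subgroup0 subgroupN) !mulr1.
    by rewrite -mulr2n -[LHS]mulr_natl G2; ring.
  rewrite !sgn_corr.
  have := theta_sum D d0.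
  rewrite !big_ord_recl big_ord0 addn0 -/D1 -/D2 => thetaE.
  suff : 4 * (theta D d)%:R = n%:R * (n%:R - 3) - n%:R * ind N d :> int.
    move=> theta4; transitivity (2 * #|G|%:R - 4 * #|D1|%:R - 4 * #|D2|%:R
        + 4 * (theta D d)%:R : int); first by rewrite thetaE natrD; ring.
    by rewrite G2 !D4 theta4 mulr0; ring.
  apply: intE; rewrite /ind; case: (boolP (d \in N)) => dN.
    rewrite !(rmorphM, rmorphB, rmorph_nat, rmorph1) /=.
    by rewrite (thetaN _ dN d0); field.
  rewrite !(rmorphM, rmorphB, rmorph_nat, rmorph1) /=.
  by rewrite (thetaNC _ dN); field.
apply: (@hadamard_of_array _ _ (bordered N H o c (sgn D1) (sgn D2))).
- exact: (card_bordered o nN GN).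
- by apply: bordered_pm => //; apply: sgn_pm.
- by apply: bordered_sym.
by apply: bordered_gram => //; apply: balD.
Qed.
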